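(* Let $\frac1p+\frac1q=1$. For any $0<\epsilon<\mathrm{diam}_p^p(S)\,\lambda$, Algorithm 2 (described in the context) finds an $\epsilon$-stationary point of $\min_{x\in S}\Phi(x)$ within $$N=\left\lceil\frac{2(\Phi(x^1)-\Phi^* )\,(\mathrm{diam}_p^p(S)\,\lambda)^{q-1}}{\epsilon^q}\right\rceil$$ steps; that is, for every sequence $(x^k)_{k\ge1}$ generated by the algorithm there is an index $1\le k\le\max\{1,N\}$ such that $x^k$ is an $\epsilon$-stationary point.
   Context: $S\subseteq\mathbf R^n$ is nonempty, compact and convex; $f:\mathbf R^n\to\mathbf R$ is differentiable (possibly nonconvex); $h:\mathbf R^n\to\mathbf R$ is convex (possibly nonsmooth); $\Phi=f+h$ and $\Phi^*=\min_{x\in S}\Phi(x)$. $\|v\|_p=(\sum_i|v_i|^p)^{1/p}$, $\mathrm{diam}_p(S)=\max_{x,y\in S}\|x-y\|_p$, $\mathrm{diam}_p^p(S)=(\mathrm{diam}_p(S))^p$. Standing assumption: $p>1$, $\lambda>0$ are such that $f(y)\le f(x)+\nabla f(x)^{\top}(y-x)+\frac{\lambda}{2}\|y-x\|_p^p$ for all $x,y\in S$. A point $x\in S$ is an $\epsilon$-stationary point of $\min_{x\in S}\Phi(x)$ if $\nabla f(x)^{\top}(y-x)+h(y)-h(x)\ge-\epsilon$ for all $y\in S$. Algorithm 2: start from $x^1\in S$. For $k=1,2,\dots$ set $x^{k+1}=\arg\min_{y\in S}\{f(x^k)+\nabla f(x^k)^{\top}(y-x^k)+\frac{\lambda}{2}\|y-x^k\|_p^p+h(y)\}$.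 *)

(* Defs.v *)
From HB Require Import structures.
From mathcomp Require Export all_boot all_order all_algebra.
From mathcomp Require Export all_classical all_reals all_analysis.

Set Implicit Arguments.
Unset Strict Implicit.
Unset Printing Implicit Defensive.

Export Order.TTheory GRing.Theory Num.Theory.
Export numFieldNormedType.Exports.

Local Open Scope classical_set_scope.
Local Open Scope ring_scope.

Section Extrema.
Context {R : realType}.

(* Both operators return the junk value 0 when the extremum is not attained. *)
Definition set_min (A : set R) : R := xget 0 [set m | A m /\ lbound A m].

Definition set_max (A : set R) : R := xget 0 [set m | A m /\ ubound A m].

Definition argmin {T : Type} (S : set T) (g : T -> R) : set T :=
  [set y | S y /\ forall z, S z -> g y <= g z].

End Extrema.

Section Euclidean.
Context {R : realType} {n : nat}.
Implicit Types (p : R) (u v x : 'rV[R]_n) (S : set 'rV[R]_n).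

(* The topology and norm that MathComp-Analysis puts on 'rV[R]_n come from the
   sup norm; the p-norm is a separate function. *)
Definition lpnorm p v : R := (\sum_(i < n) `|v 0 i| `^ p) `^ p^-1.

Definition lpdiam p S : R :=
  set_max [set lpnorm p (x - y) | x in S & y in S].

Definition dot u v : R := \sum_(i < n) u 0 i * v 0 i.

Definition grad (f : 'rV[R]_n -> R) x : 'rV[R]_n :=
  \row_(i < n) 'D_(delta_mx 0 i) f x.

Definition eps_stationary S (f h : 'rV[R]_n -> R) (eps : R) : set 'rV[R]_n :=
  [set x | S x /\
    forall y, S y -> - eps <= dot (grad f x) (y - x) + h y - h x].

Definition upper_model p (lambda : R) (f h : 'rV[R]_n -> R) x
    (y : 'rV[R]_n) : R :=
  f x + dot (grad f x) (y - x) + lambda / 2 * lpnorm p (y - x) `^ p + h y.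

(* Iterates are numbered from 1; the value xs 0 is irrelevant. *)
Definition generated S p (lambda : R) (f h : 'rV[R]_n -> R)
    (xs : nat -> 'rV[R]_n) : Prop :=
  S (xs 1%N) /\
  forall k, (1 <= k)%N ->
    argmin S (upper_model p lambda f h (xs k)) (xs k.+1).

End Euclidean.

(* Main.v *)
From mathcomp Require Import ring lra.
Require Import Defs.

Set Implicit Arguments.
Unset Strict Implicit.
Unset Printing Implicit Defensive.

Local Open Scope classical_set_scope.
Local Open Scope ring_scope.

(** Write [A = diam^p * lambda]. Suppose that the iterate [x] is not eps-
    stationary: some [y] in [S] makes the linearised gap [dot (grad f x) (y - x)
    + h y - h x] smaller than [- eps]. The next iterate [z] minimises over [S] a
    majorant of [f + h] that agrees with it at [x], so it does at least as well
    as the point at parameter [t] of the segment from [x] to [y], where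
    convexity of [h] and homogeneity of the p-norm bound the majorant. This
    gives [Phi z < Phi x - t * eps + t^p * A / 2] whenever [0 < t <= 1]
    ([argmin_model_descent]). Taking [t = (eps / A)^(q - 1)] makes [t^p * A]
    equal to [t * eps], because [(q - 1) * (p - 1) = 1]; this [t] is at most 1
    since [eps < A]. Each nonstationary step therefore decreases [Phi] by more
    than [t * eps / 2 = eps^q / (2 * A^(q - 1))] ([nonstationary_descent],
    [step_decrease]). If the first [max 1 N] iterates were all nonstationary,
    [Phi] would drop strictly below its minimum over [S].

    That the minimum is attained, so that [set_min] is the true minimum and not
    its default value, rests on compactness of [S] and continuity of [Phi].  The
    part that takes work is the continuity of a finite convex function on R^n:
    it is bounded above on a box, by the maximum over the vertices
    ([convex_box_bounded]), and a convex function bounded above near a point is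
    continuous there ([convex_upper_bounded_continuous]).  For the diameter,
    attainment is forced by [0 < eps < A]: otherwise [lpdiam] would have its
    default value 0, and [A] would vanish ([lpnorm_le_lpdiam]). *)

(** * Continuity of convex functions *)

Lemma convex_function_ineq (R : realType) (V : lmodType R) (h : V -> R)
    (x y : V) (t : R) :
  @convex_function R V setT h -> 0 <= t -> t <= 1 ->
  h (t *: x + (1 - t) *: y) <= t * h x + (1 - t) * h y.
Proof.
by move=> cvx t0 t1; apply: (cvx (Itv01 t0 t1) x y); rewrite inE.
Qed.

Lemma convex_set_segment (R : realType) (V : lmodType R) (S : set V)
    (x y : V) (t : R) :
  @convex_set R V S -> S x -> S y -> 0 <= t -> t <= 1 ->
  S (t *: y + (1 - t) *: x).
Proof.
move=> cvx Sx Sy t0 t1; apply/set_mem.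
by apply: (cvx y x (Itv01 t0 t1)); rewrite inE.
Qed.

Lemma convex_le_endpoints (R : realType) (V : lmodType R) (h : V -> R)
    (x v : V) (r s : R) :
  @convex_function R V setT h -> 0 < r -> `|s| <= r ->
  h (x + s *: v) <= Num.max (h (x - r *: v)) (h (x + r *: v)).
Proof.
move=> cvx r0; rewrite ler_norml => /andP[rs sr].
have r20 : 0 < r * 2 by rewrite mulr_gt0.
pose t := (s + r) / (r * 2).
have t0 : 0 <= t by apply: divr_ge0; lra.
have t1 : t <= 1 by rewrite ler_pdivrMr//; lra.
(* [t] is the position of [s] in the interval from [- r] to [r], rescaled to
   the unit interval. *)
have {1}-> : x + s *: v = t *: (x + r *: v) + (1 - t) *: (x - r *: v).
  have -> : s = t * r - (1 - t) * r by rewrite /t; field; rewrite gt_eqF.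
  rewrite !scalerDr scalerN !scalerA addrACA -(scalerDl x) subrKC scale1r.
  by rewrite scalerBl.
apply: (le_trans (convex_function_ineq _ _ cvx t0 t1)).
set a := h _; set b := h _.
have : t * a <= t * Num.max b a by rewrite ler_wpM2l// le_max lexx orbT.
have : (1 - t) * b <= (1 - t) * Num.max b a.
  by rewrite ler_wpM2l ?subr_ge0// le_max lexx.
lra.
Qed.

(** Adding one direction to a box replaces each of its points by a segment, on
    which [h] is at most its larger endpoint value; the endpoints lie in two
    boxes with one direction fewer and shifted centres, whence the induction on
    [s] with [x] generalised. *)
Lemma convex_box_bounded (R : realType) (n : nat) (h : 'rV[R]_n -> R)
    (r : R) (s : seq 'I_n) (x : 'rV[R]_n) :
  @convex_function R 'rV[R]_n setT h -> 0 < r ->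
  exists M, forall c : 'I_n -> R, (forall i, `|c i| <= r) ->
    h (x + \sum_(i <- s) c i *: 'e_i) <= M.
Proof.
move=> cvx r0; elim: s x => [|i s IH] x.
  by exists (h x) => c _; rewrite big_nil addr0.
have [M1 hM1] := IH (x - r *: 'e_i); have [M2 hM2] := IH (x + r *: 'e_i).
exists (Num.max M1 M2) => c cr; rewrite big_cons addrCA addrC.
apply: (le_trans (convex_le_endpoints _ _ cvx r0 (cr i))).
rewrite ge_max !le_max; apply/andP; split; apply/orP; [left|right].
  by rewrite addrAC; exact: hM1.
by rewrite addrAC; exact: hM2.
Qed.

Lemma rV_coord_le_norm (R : realType) (n : nat) (v : 'rV[R]_n) (i : 'I_n) :
  `|v 0 i| <= `|v|.
Proof.
rewrite [leRHS]mx_normrE.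
exact: (le_bigmax _ (fun ij => `|v ij.1 ij.2|) (0, i)).
Qed.

(** Shrinking towards [x] turns the bound [M] on the unit ball into
    [h (x + v) - h x <= t * (M - h x)] when [`|v| <= t].  The matching lower
    bound comes from reflection: [x] is the midpoint of [z] and of
    [x - (z - x)], so an upper bound at the reflected point is a lower bound at
    [z]. *)
Lemma convex_upper_bounded_continuous (R : realType) (V : normedModType R)
    (h : V -> R) (x : V) (M : R) :
  @convex_function R V setT h -> (forall v, `|v| <= 1 -> h (x + v) <= M) ->
  {for x, continuous h}.
Proof.
move=> cvx hM.
have upper (t : R) (v : V) : 0 < t -> t <= 1 -> `|v| <= t ->
    h (x + v) - h x <= t * (M - h x).
  move=> t0 t1 vt.
  have -> : x + v = t *: (x + t^-1 *: v) + (1 - t) *: x.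
    rewrite scalerDr scalerA divff ?gt_eqF// scale1r scalerBl scale1r.
    by rewrite addrAC subrKC.
  have := convex_function_ineq (x + t^-1 *: v) x cvx (ltW t0) t1.
  have : t * h (x + t^-1 *: v) <= t * M.
    rewrite (ler_wpM2l (ltW t0))// hM// normrZ gtr0_norm ?invr_gt0//.
    by rewrite mulrC ler_pdivrMr// mul1r.
  lra.
have Mx : 0 <= M - h x.
  by rewrite subr_ge0; have := hM 0; rewrite addr0 normr0; apply.
apply/cvgrPdist_le => e e0.
(* The [+ 1] keeps the denominator positive when [h x = M]. *)
pose t := Num.min 1 (e / (M - h x + 1)).
have M10 : 0 < M - h x + 1 by rewrite ltr_wpDl.
have t0 : 0 < t by rewrite lt_min ltr01 divr_gt0.
have t1 : t <= 1 by rewrite ge_min lexx.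
have te : t * (M - h x) <= e.
  have : t <= e / (M - h x + 1) by rewrite ge_min lexx orbT.
  rewrite ler_pdivlMr//; apply: le_trans.
  by rewrite (ler_wpM2l (ltW t0))// lerDl.
near=> z.
have zt : `|z - x| <= t.
  rewrite distrC; near: z.
  exact: (@cvgr_dist_le _ _ _ (nbhs x) _ id x cvg_id t t0).
have up := upper t (z - x) t0 t1 zt; rewrite subrKC in up.
have down := upper t (- (z - x)) t0 t1; rewrite normrN in down.
have {down} := down zt.
have half0 : 0 <= 2^-1 :> R by rewrite invr_ge0.
have half1 : 2^-1 <= 1 :> R by lra.
have := convex_function_ineq z (x - (z - x)) cvx half0 half1.
have -> : 2^-1 *: z + (1 - 2^-1) *: (x - (z - x)) = x.
  have -> : 1 - 2^-1 = 2^-1 :> R by lra.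
  rewrite -scalerDr opprB addrCA subrKC -mulr2n -(scaler_nat 2 x) scalerA.
  by rewrite mulVf ?scale1r// pnatr_eq0.
rewrite ler_norml; move: up te; lra.
Unshelve. all: by end_near.
Qed.

Lemma convex_function_continuous (R : realType) (n : nat)
    (h : 'rV[R]_n -> R) :
  @convex_function R 'rV[R]_n setT h -> continuous h.
Proof.
move=> cvx x.
have [M hM] := convex_box_bounded (index_enum 'I_n) x cvx ltr01.
apply: (convex_upper_bounded_continuous (M := M) cvx) => v v1.
rewrite [v]row_sum_delta; apply: hM => i.
exact: le_trans (rV_coord_le_norm v i) v1.
Qed.

(** * Attained extrema *)

Lemma set_min_image_le (R : realType) (T : topologicalType) (g : T -> R)
    (S : set T) (x : T) :
  S !=set0 -> compact S -> continuous g -> S x -> set_min (g @` S) <= g x.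
Proof.
move=> S0 cS cg Sx; rewrite /set_min; case: xgetP => [m _ [_]|noMin].
  by apply; exists x.
have [c /set_mem Sc cmin] := compact_EVT_min S0 cS (continuous_subspaceT cg).
exfalso; apply: (noMin (g c)); split; first by exists c.
by move=> _ [y Sy <-]; apply: cmin; rewrite inE.
Qed.

(** A nonzero value cannot be the default returned when there is no maximum. *)
Lemma set_max_ubound (R : realType) (A : set R) :
  set_max A != 0 -> ubound A (set_max A).
Proof. by rewrite /set_max; case: xgetP => [m _ []|_] //; rewrite eqxx. Qed.

(** * The p-norm *)

Lemma lpnorm_ge0 (R : realType) (n : nat) (p : R) (v : 'rV[R]_n) :
  0 <= lpnorm p v.
Proof. exact: powR_ge0. Qed.

Lemma lpnorm_powR (R : realType) (n : nat) (p : R) (v : 'rV[R]_n) :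
  p != 0 -> lpnorm p v `^ p = \sum_(i < n) `|v 0 i| `^ p.
Proof.
move=> p0; rewrite /lpnorm -powRrM mulVf// powRr1//.
by apply: sumr_ge0 => i _; exact: powR_ge0.
Qed.

Lemma lpnormZ_powR (R : realType) (n : nat) (p t : R) (v : 'rV[R]_n) :
  p != 0 -> 0 <= t -> lpnorm p (t *: v) `^ p = t `^ p * lpnorm p v `^ p.
Proof.
move=> p0 t0; rewrite !lpnorm_powR// mulr_sumr; apply: eq_bigr => i _.
by rewrite mxE normrM (ger0_norm t0) powRM.
Qed.

Lemma lpnorm_le_lpdiam (R : realType) (n : nat) (p : R)
    (S : set 'rV[R]_n) (x y : 'rV[R]_n) :
  lpdiam p S != 0 -> S x -> S y -> lpnorm p (x - y) <= lpdiam p S.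
Proof.
by move=> /set_max_ubound ub Sx Sy; apply: ub; exists x => //; exists y.
Qed.

Lemma dotZr (R : realType) (n : nat) (a : R) (u v : 'rV[R]_n) :
  dot u (a *: v) = a * dot u v.
Proof.
by rewrite /dot mulr_sumr; apply: eq_bigr => i _; rewrite mxE mulrCA.
Qed.

(** * One step of the proximal model *)

Lemma upper_model_segment (R : realType) (n : nat) (f h : 'rV[R]_n -> R)
    (p lambda t : R) (x y : 'rV[R]_n) :
  p != 0 -> 0 <= t ->
  upper_model p lambda f h x (t *: y + (1 - t) *: x) =
  f x + t * dot (grad f x) (y - x)
  + lambda / 2 * (t `^ p * lpnorm p (y - x) `^ p)
  + h (t *: y + (1 - t) *: x).
Proof.
move=> p0 t0; rewrite /upper_model.
have -> : t *: y + (1 - t) *: x - x = t *: (y - x).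
  by rewrite scalerBl scale1r addrCA addrAC subrr add0r scalerBr.
congr (_ + _ + _ * _ + _); first exact: dotZr.
exact: lpnormZ_powR.
Qed.

(** [f z + h z] is at most the model at [z], hence at most the model at any
    point of the segment from [x] to [y]. *)
Lemma argmin_model_descent (R : realType) (n : nat) (S : set 'rV[R]_n)
    (f h : 'rV[R]_n -> R) (p lambda t : R) (x y z : 'rV[R]_n) :
  @convex_set R 'rV[R]_n S -> @convex_function R 'rV[R]_n setT h ->
  p != 0 ->
  (forall x y, S x -> S y ->
     f y <= f x + dot (grad f x) (y - x)
            + lambda / 2 * lpnorm p (y - x) `^ p) ->
  S x -> S y -> argmin S (upper_model p lambda f h x) z ->
  0 <= t -> t <= 1 ->
  f z + h z <= f x + h x + t * (dot (grad f x) (y - x) + h y - h x)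
               + lambda / 2 * (t `^ p * lpnorm p (y - x) `^ p).
Proof.
move=> cvxS cvxh p0 smooth Sx Sy [Sz zmin] t0 t1.
have := zmin _ (convex_set_segment cvxS Sx Sy t0 t1).
rewrite [leRHS]upper_model_segment// /upper_model => {zmin}.
have := smooth x z Sx Sz.
have := convex_function_ineq y x cvxh t0 t1.
move: (dot _ _) (dot _ _) (lambda / 2 * _) (lambda / 2 * _) => d e a b.
lra.
Qed.

(** With [y] witnessing that [x] is not stationary, the linear gain exceeds
    [t * eps], while the p-norm penalty is at most half of
    [A * t^p = t * eps]. *)
Lemma nonstationary_descent (R : realType) (n : nat) (S : set 'rV[R]_n)
    (f h : 'rV[R]_n -> R) (p lambda eps A t : R) (x z : 'rV[R]_n) :
  @convex_set R 'rV[R]_n S -> @convex_function R 'rV[R]_n setT h ->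
  p != 0 ->
  (forall x y, S x -> S y ->
     f y <= f x + dot (grad f x) (y - x)
            + lambda / 2 * lpnorm p (y - x) `^ p) ->
  S x -> argmin S (upper_model p lambda f h x) z ->
  (forall y, S y -> lpnorm p (y - x) `^ p * lambda <= A) ->
  0 < t -> t <= 1 -> A * t `^ p = t * eps ->
  ~ eps_stationary S f h eps x ->
  f z + h z < f x + h x - t * eps / 2.
Proof.
move=> cvxS cvxh p0 smooth Sx zmin boundA t0 t1 tA nstat.
have [y Sy gap] : exists2 y, S y &
    dot (grad f x) (y - x) + h y - h x < - eps.
  apply: contrapT => noy; apply: nstat; split=> // y Sy.
  by rewrite leNgt; apply/negP => lt; apply: noy; exists y.
have := argmin_model_descent cvxS cvxh p0 smooth Sx Sy zmin (ltW t0) t1.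
have := ler_wpM2r (powR_ge0 t p) (boundA y Sy).
move: gap; rewrite -(ltr_pM2l t0) tA.
move: (dot _ _ + _ - _) (lpnorm _ _ `^ _) (t `^ p) => g b tp.
lra.
Qed.

(** * The choice of the step length *)

Section OptimalStep.
Context (R : realType) (p q A eps : R).
Hypotheses (p_gt1 : 1 < p) (pq : 1 / p + 1 / q = 1).
Hypotheses (eps_gt0 : 0 < eps) (epsA : eps < A).

Let A_gt0 : 0 < A. Proof. exact: lt_trans epsA. Qed.

Let ratio_gt0 : 0 < eps / A. Proof. exact: divr_gt0. Qed.

Lemma conjugate_exponent_gt1 : 1 < q.
Proof.
have p0 : 0 < p by exact: lt_trans p_gt1.
have ip : p^-1 < 1 by rewrite invf_lt1.
have iq : q^-1 = 1 - p^-1 by move: pq; rewrite !mul1r; lra.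
have ip0 : 0 < p^-1 by rewrite invr_gt0.
have q0 : 0 < q by rewrite -invr_gt0; lra.
by rewrite -invf_lt1//; lra.
Qed.

Lemma conjugate_exponent_subr1 : (q - 1) * (p - 1) = 1.
Proof.
have p0 : p != 0 by rewrite gt_eqF// (lt_trans _ p_gt1).
have q0 : q != 0 by rewrite gt_eqF// (lt_trans _ conjugate_exponent_gt1).
have : p + q = p * q.
  have := congr1 (fun x => p * q * x) pq.
  rewrite mulrDr !mul1r mulr1 mulfK// mulrAC mulfV// mul1r => <-.
  by rewrite addrC.
lra.
Qed.

(** The bound [- t * eps + t^p * A / 2] on the change of the objective is
    minimised, up to a constant factor in [t], where [t^(p - 1) = eps / A]; as
    [1 / (p - 1) = q - 1], that is this [t]. *)
Let t := (eps / A) `^ (q - 1).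

Lemma step_gt0 : 0 < t. Proof. exact: powR_gt0. Qed.

Lemma step_le1 : t <= 1.
Proof.
have -> : 1 = 1 `^ (q - 1) :> R by rewrite powR1.
rewrite ge0_ler_powR ?nnegrE ?ler01 ?(ltW ratio_gt0)//.
  by rewrite subr_ge0 ltW// conjugate_exponent_gt1.
by rewrite ler_pdivrMr// mul1r ltW.
Qed.

Lemma step_powR : A * t `^ p = t * eps.
Proof.
have p0 : 0 < p by exact: lt_trans p_gt1.
rewrite -(mulr_powRB1 (ltW step_gt0) p0) -powRrM conjugate_exponent_subr1.
rewrite powRr1 ?(ltW ratio_gt0)// mulrCA; congr (_ * _).
by rewrite mulrC divfK ?gt_eqF.
Qed.

Lemma step_decrease : t * eps * A `^ (q - 1) = eps `^ q.
Proof.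
have q0 : 0 < q by exact: lt_trans conjugate_exponent_gt1.
rewrite mulrAC -powRM ?(ltW ratio_gt0) ?(ltW A_gt0)//.
by rewrite divfK ?gt_eqF// mulrC mulr_powRB1// ltW.
Qed.

End OptimalStep.

(** * Iteration count *)

Lemma strict_decrease_telescope (R : realType) (u : nat -> R) (c : R)
    (m : nat) :
  (forall k, (1 <= k <= m.+1)%N -> u k.+1 < u k - c) ->
  u m.+2 < u 1%N - m.+1%:R * c.
Proof.
elim: m => [|m IH] dec; first by rewrite mul1r; exact: dec.
have := dec m.+2; rewrite leqnn => /(_ isT).
have : u m.+2 < u 1%N - m.+1%:R * c.
  by apply: IH => k /andP[k1 km]; apply: dec; rewrite k1 leqW.
rewrite -[m.+2%:R]natr1; lra.
Qed.

Theorem theorem3p3 (R : realType) (n : nat) (S : set 'rV[R]_n)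
    (f h : 'rV[R]_n -> R) (p q lambda eps : R) (xs : nat -> 'rV[R]_n)
    (S_nonempty : S !=set0)
    (S_compact : compact S)
    (S_convex : @convex_set R 'rV[R]_n S)
    (f_differentiable : forall x, differentiable f x)
    (h_convex : @convex_function R 'rV[R]_n setT h)
    (p_gt1 : 1 < p)
    (lambda_gt0 : 0 < lambda)
    (f_smooth : forall x y, S x -> S y ->
      f y <= f x + dot (grad f x) (y - x)
             + lambda / 2 * lpnorm p (y - x) `^ p)
    (pq_conjugate : 1 / p + 1 / q = 1)
    (eps_gt0 : 0 < eps)
    (eps_lt : eps < lpdiam p S `^ p * lambda)
    (xs_generated : generated S p lambda f h xs) :
  let Phi := fun x => f x + h x in
  let Phi_star := set_min (Phi @` S) in
  let N := Num.ceil (2 * (Phi (xs 1%N) - Phi_star)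
                     * (lpdiam p S `^ p * lambda) `^ (q - 1)
                     / eps `^ q) in
  exists k : nat,
    (1 <= k)%N /\ k%:Z <= Num.max 1 N /\ eps_stationary S f h eps (xs k).
Proof.
move=> Phi Phi_star N; set A := lpdiam p S `^ p * lambda in N eps_lt *.
have p_neq0 : p != 0 by rewrite gt_eqF// (lt_trans _ p_gt1).
have diam_neq0 : lpdiam p S != 0.
  apply/eqP => D0; move: eps_lt; rewrite /A D0 powR0// mul0r.
  by rewrite ltNge (ltW eps_gt0).
have [S1 iter] := xs_generated.
have Sxs k : (1 <= k)%N -> S (xs k).
  by case: k => [//|[|k]] _ //; have [] := iter k.+1 isT.
have A_gt0 : 0 < A by exact: lt_trans eps_lt.
pose t := (eps / A) `^ (q - 1).
have t_gt0 : 0 < t := step_gt0 q eps_gt0 eps_lt.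
have t_le1 : t <= 1 := step_le1 p_gt1 pq_conjugate eps_gt0 eps_lt.
have tp : A * t `^ p = t * eps :=
  step_powR p_gt1 pq_conjugate eps_gt0 eps_lt.
pose c := t * eps / 2.
have c_gt0 : 0 < c by rewrite divr_gt0// mulr_gt0.
have decrease k : (1 <= k)%N -> ~ eps_stationary S f h eps (xs k) ->
    Phi (xs k.+1) < Phi (xs k) - c.
  move=> k1 nstat.
  apply: (nonstationary_descent S_convex h_convex p_neq0 f_smooth (Sxs _ k1)
    (iter k k1) _ t_gt0 t_le1 tp nstat) => y Sy.
  rewrite ler_pM2r//; apply: ge0_ler_powR; rewrite ?nnegrE ?lpnorm_ge0//.
  - by rewrite ltW// (lt_trans _ p_gt1).
  - apply: le_trans (lpnorm_ge0 p (y - xs k)) _.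
    by apply: lpnorm_le_lpdiam => //; exact: Sxs.
  - by apply: lpnorm_le_lpdiam => //; exact: Sxs.
have Phi_cont : continuous Phi.
  move=> x; apply: (@continuousD _ _ _ f h x).
    exact: differentiable_continuous.
  exact: convex_function_continuous.
(* [c] is [eps^q / (2 * A^(q - 1))], so [N] is the ceiling of
   [(Phi (xs 1) - Phi_star) / c]. *)
have N_big : Phi (xs 1%N) - Phi_star <= N%:~R * c.
  have Aq_gt0 : 0 < A `^ (q - 1) by exact: powR_gt0.
  have eq_gt0 : 0 < eps `^ q by exact: powR_gt0.
  have te : t * eps * A `^ (q - 1) = eps `^ q :=
    step_decrease p_gt1 pq_conjugate eps_gt0 eps_lt.
  have -> : Phi (xs 1%N) - Phi_star =
      2 * (Phi (xs 1%N) - Phi_star) * A `^ (q - 1) / eps `^ q * c.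
    rewrite -te /c; field.
    by rewrite !gt_eqF.
  by rewrite ler_pM2r// ceil_ge.
(* [max 1 N] is positive, so it has the successor form [m.+1] that the
   telescoping argument asks for. *)
pose m := absz (Num.max 1 N - 1)%R.
have mE : m.+1%:Z = Num.max 1 N.
  by rewrite -addn1 PoszD /m gez0_abs ?subrK// subr_ge0 le_max lexx.
apply: contrapT => none.
have /strict_decrease_telescope : forall k, (1 <= k <= m.+1)%N ->
    Phi (xs k.+1) < Phi (xs k) - c.
  move=> k /andP[k1 km]; apply: decrease => // stat; apply: none.
  by exists k; rewrite -mE lez_nat.
apply/negP; rewrite -leNgt.
have : Phi_star <= Phi (xs m.+2).
  by apply: set_min_image_le => //; exact: Sxs.
have : N%:~R * c <= m.+1%:R * c.
  by rewrite ler_pM2r// -[m.+1%:R]/(m.+1%:Z%:~R) ler_int mE le_max lexx orbT.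
move: N_big; lra.
Qed.
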